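(* Let $n\ge 2$, $m\ge 1$, $I=[t_0,+\infty)$, $A\in\mathbb R^{n\times n}$, let a class $\mathcal K_1(A)$ be given, and let $f\in\mathcal K_1^{n\times 1}(A)$. Let $\varphi_0(t,c_0)$ (parameter $c_0\in\mathbb R^{n_0}$, $0\le n_0\le n$) be some particular solution, of class $\mathcal K_1^{n\times 1}(A)\cap C^1(I)$, of $\frac{d\varphi}{dt}=A\varphi+f(t)$, $t\in I$. Let $a>0$ and $D:=\{(t,y): t\in I,\ y\in\mathbb R^{n\times 1},\ \|y-\varphi_0(t,c_0)\|\le a\}$. Consider $$\frac{dy}{dt}=Ay+f(t)+\sum_{l=1}^m\varepsilon_l(t)f_l(t,y),\qquad (t,y)\in D, \qquad ( * )$$ and suppose that 1. $\varepsilon_l:I\to\mathbb R$, $\varepsilon_l\in C^\infty(I)$, and $\frac{d^s\varepsilon_l(t)}{dt^s}=o(1)$ as $t\to+\infty$ for $l=1,\dots,m$, $s\in\mathbb N_0$; 2. $f_l:D\to\mathbb R^{n\times 1}$, $f_l\in C^{0,\infty}_{t,y}(D)$ for $l=1,\dots,m$; 3. $\sup_{(t,y)\in D}\|\partial_y^{\wp}f_l(t,y)\|<+\infty$ and $\partial_y^\wp f_l(t,\varphi_0(t,c_0))\in\mathcal K_1^{n\times 1}(A)$ for all $\wp\in\mathbb N_0^n$, $l=1,\dots,m$; 4. ranks $\varrho_l\in\mathbb R^+$ of the functions $\varepsilon_l$ are given, with $\varrho_1\le\dots\le\varrho_m$, and the ranks of products of the $\varepsilon_l$ and their derivatives are defined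 from them as in the context. Then $( * )$ has at least one formal particular solution of the form $$\tilde y=\varphi_0(t,c_0)+\sum_{s=1}^\infty\sum_{p=1}^{\varkappa_s}\nu_{sp}(t)\,\varphi_{sp}(t,c_{sp}),\qquad t\in I,$$ where the vector functions $\varphi_{sp}(t,c_{sp})\in\mathcal K_1^{n\times 1}(A)\cap C^1(I)$ (parameters $c_{sp}\in\mathbb R^{n_{sp}}$, $n_{sp}\in\{0,1,\dots,n\}$, $s\in\mathbb N$, $p=1,\dots,\varkappa_s$) are determined recursively from the infinite sequence of collections of vector differential equations $$\frac{d\varphi_{sp}(t)}{dt}=A\varphi_{sp}(t)+g_{sp}\bigl(t,\varphi_0(t,c_0),\varphi_{11}(t,c_{11}),\dots,\varphi_{s-1\,\varkappa_{s-1}}(t,c_{s-1\,\varkappa_{s-1}})\bigr),\quad p=1,\dots,\varkappa_s,\ s\in\mathbb N.$$ (The formal family of solutions can depend on no more than $n$ arbitrary scalar constants.)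
   Context: Notation: $\mathbb N_0=\{0\}\cup\mathbb N$; $\mathbb R^+=(0,+\infty)$; $\|\cdot\|$ of a matrix or vector is the maximum modulus of its entries; $S^{n\times 1}$ denotes $n$-vectors with entries in the class $S$; for $\wp\in\mathbb N_0^n$, $|\wp|=\sum_j\wp_j$, $\wp!=\prod_j\wp_j!$, $y^\wp=\prod_j y_j^{\wp_j}$, and $\partial_y^\wp$ is the corresponding partial derivative in $y$. $C^{0,\infty}_{t,y}(D)$: all partial $y$-derivatives of all orders exist and are continuous on $D$. Empty sums are $0$, empty products are $1$. A parameter in $\mathbb R^0$ means no parameter. $\Lambda(A)$ is the spectrum of $A$. Class $\mathcal K_1(A)$: some nonempty class of functions $f:I\to\mathbb R$ such that (1) every $f$ in it is continuous and bounded on $I$; (2) if $f_1,f_2\in\mathcal K_1(A)$, $\alpha\in\mathbb R$, then $\alpha f_1,\ f_1+f_2,\ f_1f_2\in\mathcal K_1(A)$; (3) for every $\tilde f:I\to\mathbb C$ with $\Re\tilde f,\Im\tilde f\in\mathcal K_1(A)$ and every $\lambda\in\Lambda(A)$, the equation $\frac{dy}{dt}=\lambda y+\tilde f(t)$ ($y:I\to\mathbb C$) has at least one particular solution $y(t,\tilde c)$ on $I$ (parameter $\tilde c\in\mathbb C^{\tilde n}$, $0\le\tilde n\le1$) with $\Re y,\Im y\in\mathcal K_1(A)\cap C^1(I)$. Ranks: $\operatorname{Rank}(\varepsilon_l)=\varrho_l$. A product $\nu_\eta(t)=\prod_{l=1}^m\prod_{r=0}^{k_l}\bigl(\frac{d^r\varepsilon_l(t)}{dt^r}\bigr)^{\beta_{lr}}$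 with $k_l,\beta_{lr}\in\mathbb N_0$, not all $\beta_{lr}$ zero, has rank $\sum_{l=1}^m\sum_{r=0}^{k_l}(\varrho_l+r)\beta_{lr}$ (rank is attached to the exponents, i.e. products are regarded as formal monomials in the $\varepsilon_l$ and their derivatives). The set of all ranks is discrete and is enumerated increasingly as $\rho_1<\rho_2<\dots$ (so $\rho_1=\varrho_1$). For each $s$, $\nu_{s1},\dots,\nu_{s\varkappa_s}$ is an enumeration of the products of rank $\rho_s$, with $\nu_{1p}=\varepsilon_p$ for $p=1,\dots,\varkappa_1$. Formal solution: put $\tilde\delta=\sum_{s\ge1}\sum_{p}\nu_{sp}\varphi_{sp}$. Formal differentiation of $\tilde y$ is termwise, with $d\nu_{sp}/dt$ expanded by the product rule as a linear combination of products of rank $\rho_s+1$; $f_l(t,\tilde y)$ is replaced by the formal Taylor series $\sum_{\wp\in\mathbb N_0^n}\frac1{\wp!}\partial_y^\wp f_l(t,\varphi_0(t,c_0))\tilde\delta^{\wp}$, multiplied out. $\tilde y$ is a formal solution if, after substitution in $( * )$, the terms free of the $\nu_{sp}$ agree on both sides and the coefficients of each $\nu_{sp}$ agree. Accordingly, $g_{sp}$ is the coefficient of $\nu_{sp}$ in $$-\sum_{s'\ge1}\sum_{p'}\frac{d\nu_{s'p'}}{dt}\varphi_{s'p'}+\sum_{l=1}^m\varepsilon_l\sum_{\wp\in\mathbb N_0^n}\frac1{\wp!}\partial_y^\wp f_l(t,\varphi_0(t,c_0))\tilde\delta^{\wp},$$ which involves only $\varphi_0$ and the $\varphi_{s'p'}$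 with $s'<s$. *)

(* Defs.v *)
From HB Require Import structures.
From mathcomp Require Import all_boot all_order all_algebra.
From mathcomp Require Import finmap multiset.
From mathcomp Require Import complex.
From mathcomp Require Import all_classical all_reals all_analysis.

Set Implicit Arguments.
Unset Strict Implicit.
Unset Printing Implicit Defensive.

Import Order.TTheory GRing.Theory Num.Theory.
Import numFieldNormedType.Exports.

Local Open Scope classical_set_scope.
Local Open Scope ring_scope.

(* Functions given on a set S are represented by total functions of which only
   the values on S matter; derivatives are therefore taken along S, so they are
   one-sided at the end points of an interval S. *)

Section DerivativeAlongASet.
Context {R : realType} {V : normedModType R}.

Definition diff_quotient (g : R -> V) (x h : R) : V :=
  h^-1 *: (g (x + h) - g x).

Definition increments (S : set R) (x : R) : set_system R :=
  within [set h | S (x + h)] 0^'.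

Definition derivable_on (S : set R) (g : R -> V) (x : R) : Prop :=
  cvg (diff_quotient g x @ increments S x).

Definition derive_on (S : set R) (g : R -> V) (x : R) : V :=
  lim (diff_quotient g x @ increments S x).

Definition C1_on (S : set R) (g : R -> V) : Prop :=
  (forall x, S x -> derivable_on S g x) /\
  {within S, continuous (derive_on S g)}.

Definition Cinf_on (S : set R) (g : R -> V) : Prop :=
  forall k x, S x -> derivable_on S (iter k (derive_on S) g) x.

End DerivativeAlongASet.

Section PartialDerivatives.
Context {R : realType} {n : nat}.
Variable D : set (R * 'cV[R]_n).

(* The map x |-> g(t, y + x e_j), and the set of the x at which it is given. *)
Definition line_fun (j : 'I_n) (g : R -> 'cV[R]_n -> 'cV[R]_n)
    (t : R) (y : 'cV[R]_n) (x : R) : 'cV[R]_n :=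
  g t (y + x *: delta_mx j 0).

Definition line_dom (j : 'I_n) (t : R) (y : 'cV[R]_n) : set R :=
  [set x | D (t, y + x *: delta_mx j 0)].

Definition pderiv (j : 'I_n) (g : R -> 'cV[R]_n -> 'cV[R]_n) :
    R -> 'cV[R]_n -> 'cV[R]_n :=
  fun t y => derive_on (line_dom j t y) (line_fun j g t y) 0.

Definition pderivs (w : seq 'I_n) (g : R -> 'cV[R]_n -> 'cV[R]_n) :
    R -> 'cV[R]_n -> 'cV[R]_n :=
  foldr pderiv g w.

(* Partial derivatives in y of all orders, in any order of differentiation,
   exist and are jointly continuous on D. *)
Definition C0inf (g : R -> 'cV[R]_n -> 'cV[R]_n) : Prop :=
  forall w : seq 'I_n,
    {within D, continuous (fun p : R * 'cV[R]_n => pderivs w g p.1 p.2)} /\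
    forall j t y, D (t, y) ->
      derivable_on (line_dom j t y) (line_fun j (pderivs w g) t y) 0.

Definition multi_pderiv (wp : {ffun 'I_n -> nat})
    (g : R -> 'cV[R]_n -> 'cV[R]_n) : R -> 'cV[R]_n -> 'cV[R]_n :=
  pderivs (flatten [seq nseq (wp j) j | j <- enum 'I_n]) g.

End PartialDerivatives.

Section ClassK1.
Context {R : realType}.

Definition half_line (t0 : R) : set R := `[t0, +oo[.

(* dy/dt = lambda y + g for y : I -> C, in real and imaginary parts. *)
Definition complex_scalar_solution (I : set R) (lambda : R[i])
    (g y : R -> R[i]) : Prop :=
  forall t, I t ->
    [/\ derivable_on I (fun u => complex.Re (y u)) t,
        derivable_on I (fun u => complex.Im (y u)) t,
        derive_on I (fun u => complex.Re (y u)) t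
          = complex.Re (lambda * y t + g t)
      & derive_on I (fun u => complex.Im (y u)) t
          = complex.Im (lambda * y t + g t)].

(* K1_ext makes K a class of functions on I: membership does not depend on the
   values outside I. *)
Record is_class_K1 (n : nat) (I : set R) (A : 'M[R]_n) (K : set (R -> R)) :
    Prop := IsClassK1 {
  K1_ext : forall g h, (forall t, I t -> g t = h t) -> K g -> K h;
  K1_nonempty : K !=set0;
  K1_continuous : forall g, K g -> {within I, continuous g};
  K1_bounded : forall g, K g -> exists M : R, forall t, I t -> `|g t| <= M;
  K1_scale : forall (alpha : R) g, K g -> K (fun t => alpha * g t);
  K1_add : forall g h, K g -> K h -> K (fun t => g t + h t);
  K1_mul : forall g h, K g -> K h -> K (fun t => g t * h t);
  K1_scalar_equation : forall (g : R -> R[i]) (lambda : R[i]),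
    K (fun t => complex.Re (g t)) -> K (fun t => complex.Im (g t)) ->
    eigenvalue (map_mx (real_complex R) A) lambda ->
    exists (k : nat) (y : 'rV[R[i]]_k -> R -> R[i]),
      (k <= 1)%N /\
      forall c : 'rV[R[i]]_k,
        [/\ complex_scalar_solution I lambda g (y c),
            K (fun t => complex.Re (y c t)), K (fun t => complex.Im (y c t)),
            C1_on I (fun t => complex.Re (y c t))
          & C1_on I (fun t => complex.Im (y c t))] }.

Definition vect_in (n : nat) (K : set (R -> R)) (v : R -> 'cV[R]_n) : Prop :=
  forall i, K (fun t => v t i 0).

End ClassK1.

(* The formal monomial \prod_(l, r) (d^r eps_l / dt^r)^(beta_lr) is the multiset
   in which (l, r) has multiplicity beta_lr; the sum of multisets is the product
   of monomials, and the empty multiset is the monomial 1. *)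
Definition monomial (m : nat) : choiceType := {mset ('I_m * nat)%type}%mset.

Section FormalSeries.
Context {R : realType} {m : nat}.
Local Open Scope mset_scope.

Definition mrank (varrho : 'I_m -> R) (q : monomial m) : R :=
  \sum_(x <- finsupp q) (varrho x.1 + x.2%:R) * (q x)%:R.

Definition raise (x : 'I_m * nat) : 'I_m * nat := (x.1, x.2.+1).

(* The coefficient of q in d q' / dt: by the product rule, each (l, r) in q'
   contributes beta_lr times the monomial in which one factor d^r eps_l / dt^r
   is replaced by d^(r+1) eps_l / dt^(r+1). *)
Definition dmonomial (q' q : monomial m) : nat :=
  (\sum_(x <- finsupp q') if raise x +` (q' `\ x) == q then q' x else 0)%N.

(* A formal series \sum_q q * F q is the family F of its coefficients. *)
Definition fseries (V : Type) := monomial m -> V.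

Definition fmonom (q0 : monomial m) : fseries R := fun q => (q == q0)%:R.

(* In the definitions below the sums over infinite index sets have only
   finitely many nonzero terms: \sum_(i \in A) is the sum over the support. *)
Definition fmul (V : lmodType R) (F : fseries R) (G : fseries V) : fseries V :=
  fun q => \sum_(p \in [set p : monomial m * monomial m | p.1 `+` p.2 = q])
             F p.1 *: G p.2.

Definition fmulr (F G : fseries R) : fseries R := fmul F (G : fseries R^o).

Definition fexp (F : fseries R) (k : nat) : fseries R :=
  iter k (fmulr F) (fmonom mset0).

Section Vectors.
Context {n : nat}.

Definition fpow (F : fseries 'cV[R]_n) (wp : {ffun 'I_n -> nat}) : fseries R :=
  \big[fmulr/fmonom mset0]_(j < n) fexp (fun q => F q j 0) (wp j).

(* \sum_wp 1/wp! d_wp F^wp, multiplied out. *)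
Definition ftaylor (d : {ffun 'I_n -> nat} -> 'cV[R]_n)
    (F : fseries 'cV[R]_n) : fseries 'cV[R]_n :=
  fun q => \sum_(wp \in [set: {ffun 'I_n -> nat}])
             ((\prod_(j < n) (wp j)`!)%:R^-1 * fpow F wp q) *: d wp.

(* \sum_l eps_l f_l(t, phi0 + delta), where d l wp = d_y^wp f_l(t, phi0). *)
Definition fperturbation (d : 'I_m -> {ffun 'I_n -> nat} -> 'cV[R]_n)
    (delta : fseries 'cV[R]_n) : fseries 'cV[R]_n :=
  fun q => \sum_(l < m)
             fmul (fmonom [mset (l, 0%N)]) (ftaylor (d l) delta) q.

(* \sum_q (d q / dt) * F q. *)
Definition fderiv_monomials (F : fseries 'cV[R]_n) : fseries 'cV[R]_n :=
  fun q => \sum_(q' \in [set: monomial m]) (dmonomial q' q)%:R *: F q'.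

Definition fderiv (I : set R) (Y : fseries (R -> 'cV[R]_n)) (t : R) :
    fseries 'cV[R]_n :=
  fun q => derive_on I (Y q) t + fderiv_monomials (fun q' => Y q' t) q.

(* Y = \sum_q q * Y q satisfies dY/dt = A Y + f + \sum_l eps_l f_l(t, Y)
   coefficient by coefficient, where Y mset0 is the term free of the eps_l and
   d l wp t = d_y^wp f_l(t, Y mset0 t). *)
Definition formal_solution (I : set R) (A : 'M[R]_n) (f : R -> 'cV[R]_n)
    (d : 'I_m -> {ffun 'I_n -> nat} -> R -> 'cV[R]_n)
    (Y : fseries (R -> 'cV[R]_n)) : Prop :=
  forall t, I t -> forall q : monomial m,
    derivable_on I (Y q) t /\
    fderiv I Y t q =
      A *m Y q t + (if q == mset0 then f t else 0)
      + fperturbation (fun l wp => d l wp t)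
          (fun q' => if q' == mset0 then 0 else Y q' t) q.

End Vectors.

(* Indices are shifted by one: rho s, kappa s, nu s p with s, p >= 0 stand for
   rho_(s+1), kappa_(s+1), nu_(s+1,p+1). *)
Record rank_enumeration (varrho : 'I_m -> R) (rho : nat -> R)
    (kappa : nat -> nat) (nu : forall s, 'I_(kappa s) -> monomial m) :
    Prop := RankEnumeration {
  rho_increasing : forall s s', (s < s')%N -> rho s < rho s';
  rho_range : range rho = [set mrank varrho q | q in [set q | q != mset0]];
  nu_injective : forall s, injective (@nu s);
  nu_range : forall s,
    range (@nu s) = [set q | q != mset0 /\ mrank varrho q = rho s];
  nu_first : forall p : 'I_(kappa 0%N),
    exists2 l : 'I_m, l = p :> nat & @nu 0%N p = [mset (l, 0%N)] }.

Definition sp_index (kappa : nat -> nat) : choiceType :=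
  {s : nat & 'I_(kappa s)}.

Section Enumerated.
Context {n : nat} {kappa : nat -> nat}.
Variable nu : forall s, 'I_(kappa s) -> monomial m.

Definition nu_of (sp : sp_index kappa) : monomial m := nu (tagged sp).

(* \sum_s \sum_p nu_sp phi_sp, as a family of coefficients. *)
Definition fdelta (phi : sp_index kappa -> R -> 'cV[R]_n) :
    fseries (R -> 'cV[R]_n) :=
  fun q t => \sum_(sp \in [set sp | nu_of sp = q]) phi sp t.

Definition fansatz (phi0 : R -> 'cV[R]_n)
    (phi : sp_index kappa -> R -> 'cV[R]_n) : fseries (R -> 'cV[R]_n) :=
  fun q t => (if q == mset0 then phi0 t else 0) + fdelta phi q t.

Definition g_coef (d : 'I_m -> {ffun 'I_n -> nat} -> R -> 'cV[R]_n)
    (phi : sp_index kappa -> R -> 'cV[R]_n) (sp : sp_index kappa) (t : R) :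
    'cV[R]_n :=
  - fderiv_monomials (fun q => fdelta phi q t) (nu_of sp)
  + fperturbation (fun l wp => d l wp t) (fun q => fdelta phi q t) (nu_of sp).

End Enumerated.

End FormalSeries.

(* D = {(t, y) : t in I, ||y - phi0(t)|| <= a}; the norm of a matrix is the
   maximum modulus of its entries. *)
Definition tube {R : realType} {n : nat} (I : set R) (phi0 : R -> 'cV[R]_n)
    (a : R) : set (R * 'cV[R]_n) :=
  [set p | I p.1 /\ `|p.2 - phi0 p.1| <= a].

Definition linear_solution {R : realType} {n : nat} (I : set R) (A : 'M[R]_n)
    (g phi : R -> 'cV[R]_n) : Prop :=
  forall t, I t ->
    derivable_on I phi t /\ derive_on I phi t = A *m phi t + g t.

(* Main.v *)
Require Import Defs.
From mathcomp Require Import all_boot all_order all_algebra.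
From mathcomp Require Import finmap multiset.
From mathcomp Require Import complex.
From mathcomp Require Import all_classical all_reals all_analysis.

Set Implicit Arguments.
Unset Strict Implicit.
Unset Printing Implicit Defensive.

Import Order.TTheory GRing.Theory Num.Theory.
Import numFieldNormedType.Exports.

Local Open Scope classical_set_scope.
Local Open Scope ring_scope.

(* The coefficients phi_sp are found level by level: g_sp involves only
   coefficients of rank smaller than rho_s, and each equation y' = A y + g with
   g in K1(A) has a solution in K1(A).  For the latter, work over the complex
   numbers with the product of the A - l over the roots l of the characteristic
   polynomial of A, which vanishes by Cayley-Hamilton; splitting off one factor
   at a time reduces the system to scalar equations y' = l y + g.  One solution
   with no free parameters suffices, so every n_sp is taken to be 0. *)

(** * Linear systems with inhomogeneity in the class K1(A) *)

Lemma col_sum_delta (R : pzRingType) n (v : 'cV[R]_n) :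
  v = \sum_i v i 0 *: delta_mx i 0.
Proof.
by rewrite {1}(matrix_sum_delta v); apply: eq_bigr => i _; rewrite big_ord1.
Qed.

(** In transposed form: right multiplication by [pinvmx B *m B] maps into the row space of [B] and
    fixes that space, and the rows of [B := kermx M^T] span the left kernel of [M^T]. *)
Lemma kernel_projection (F : fieldType) n (M : 'M[F]_n) :
  exists Q : 'M[F]_n, M *m Q = 0 /\ forall v : 'cV[F]_n, M *m v = 0 -> Q *m v = v.
Proof.
exists (pinvmx (kermx M^T) *m kermx M^T)^T; split.
  by apply: trmx_inj; rewrite trmx_mul trmxK -mulmxA mulmx_ker mulmx0 trmx0.
move=> v Mv; apply: trmx_inj; rewrite trmx_mul trmxK mulmxA mulmxKpV //.
by apply/sub_kermxP; rewrite -trmx_mul Mv trmx0.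
Qed.

(** The head of the list is the rightmost factor, hence the first to act on a column; the induction
    on the list strips factors in this order. *)
Definition mx_root_prod (F : fieldType) n (M : 'M[F]_n) (s : seq F) : 'M[F]_n :=
  foldr (fun l P => P *m (M - l%:M)) 1%:M s.

Lemma mx_root_prod_eigenvalues (F : closedFieldType) n (M : 'M[F]_n) :
  exists2 s : seq F, all (eigenvalue M) s & mx_root_prod M s = 0.
Proof.
case: n M => [|n] M; first by exists [::] => //; apply/matrixP => - [].
have [s sE] := closed_field_poly_normal (char_poly M).
have {}sE : char_poly M = \prod_(z <- s) ('X - z%:P).
  by rewrite {1}sE (monicP (char_poly_monic _)) scale1r.
exists s.
  by apply/allP => z zs; rewrite eigenvalue_root_char sE root_prod_XsubC.
rewrite -[RHS](Cayley_Hamilton M) sE {sE}.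
elim: s => [|z s IHs] /=; first by rewrite big_nil !rmorph1.
(* Polynomial factors commute, so the head factor can be moved to the right before evaluation at
   [M]. *)
by rewrite IHs big_cons mulrC rmorphM/= rmorphB/= horner_mx_X horner_mx_C mulmxE.
Qed.

(** * Derivatives along a set, with the limit made explicit *)

Section DerivativeRules.
Context {R : realType}.
Implicit Types t : R.

Definition has_derive {V : normedModType R} (S : set R) (g : R -> V) (t : R)
    (l : V) : Prop :=
  diff_quotient g t @ increments S t --> l.

#[local] Instance increments_filter (S : set R) t : Filter (increments S t).
Proof. exact: within_filter. Qed.

(** Points to the right of [t] stay in the half-line, so small positive increments are always
    available. Properness is what makes the derivative unique. *)
Lemma increments_half_line_proper t0 t :
  half_line t0 t -> ProperFilter (increments (half_line t0) t).
Proof.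
move=> It; apply: Build_ProperFilter_ex => P.
rewrite /increments /within /= => /nbhs_ballP[e /= e0 eP].
exists (e / 2).
have e2 : 0 < e / 2 by rewrite divr_gt0.
apply: eP => /=.
- by rewrite /ball /= sub0r normrN gtr0_norm// ltr_pdivrMr// ltr_pMr// ltr1n.
- by rewrite gt_eqF.
- move: It; rewrite /half_line /= !in_itv /= !andbT => It.
  by rewrite (le_trans It)// lerDl ltW.
Qed.

Section Rules.
Context {V : normedModType R} (S : set R) (t : R).
Implicit Types g h : R -> V.

Lemma has_derive_cst (v : V) : has_derive S (fun=> v) t 0.
Proof.
rewrite /has_derive (_ : diff_quotient _ _ = fun=> 0); first exact: cvg_cst.
by apply/funext => x; rewrite /diff_quotient subrr scaler0.
Qed.

Lemma has_deriveD g h l l' :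
  has_derive S g t l -> has_derive S h t l' ->
  has_derive S (fun u => g u + h u) t (l + l').
Proof.
move=> gl hl; rewrite /has_derive.
rewrite (_ : diff_quotient _ _ = diff_quotient g t + diff_quotient h t).
  exact: cvgD.
apply/funext => x; rewrite /diff_quotient fctE -scalerDr; congr (_ *: _).
by rewrite opprD addrACA.
Qed.

Lemma has_deriveZ (c : R -> R) l (v : V) :
  has_derive S c t l -> has_derive S (fun u => c u *: v) t (l *: v).
Proof.
move=> cl; rewrite /has_derive.
rewrite (_ : diff_quotient _ _ = fun x => diff_quotient c t x *: v).
  exact: cvgZr_tmp.
by apply/funext => x; rewrite /diff_quotient -scalerBl scalerA.
Qed.

Lemma has_derive_sum (J : Type) (r : seq J) (g : J -> R -> V) (l : J -> V) :
  (forall j, has_derive S (g j) t (l j)) ->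
  has_derive S (fun u => \sum_(j <- r) g j u) t (\sum_(j <- r) l j).
Proof.
move=> gl; elim: r => [|j r IHr].
  rewrite big_nil; rewrite (_ : (fun u => _) = fun=> 0); first exact: has_derive_cst.
  by apply/funext => u; rewrite big_nil.
rewrite big_cons; rewrite (_ : (fun u => _) = fun u => g j u + \sum_(j <- r) g j u).
  exact: has_deriveD.
by apply/funext => u; rewrite big_cons.
Qed.

End Rules.

Lemma has_deriveMl (S : set R) (t a : R) (g : R -> R) l :
  has_derive S g t l -> has_derive S (fun u => a * g u) t (a * l).
Proof.
move=> gl; rewrite mulrC.
rewrite (_ : (fun u => _) = fun u => g u *: (a : R^o)); first exact: has_deriveZ.
by apply/funext => u; rewrite mulrC.
Qed.

(** In the standard basis a column is a finite sum of scalar functions times constant vectors. *)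
Lemma has_derive_col (S : set R) (t : R) n (v : R -> 'cV[R]_n) (l : 'cV[R]_n) :
  (forall i, has_derive S (fun u => v u i 0) t (l i 0)) -> has_derive S v t l.
Proof.
move=> vl; rewrite (col_sum_delta l).
rewrite (_ : v = fun u => \sum_i v u i 0 *: delta_mx i 0).
  by apply: has_derive_sum => i; exact: has_deriveZ.
by apply/funext => u; exact: col_sum_delta.
Qed.

Lemma has_derive_on (V : normedModType R) t0 (g : R -> V) t l :
  half_line t0 t -> has_derive (half_line t0) g t l ->
  derivable_on (half_line t0) g t /\ derive_on (half_line t0) g t = l.
Proof.
move=> /increments_half_line_proper It gl; split; first by apply: cvgP gl.
exact: cvg_lim gl.
Qed.

Lemma derivable_onP (V : normedModType R) (S : set R) (g : R -> V) t :
  derivable_on S g t -> has_derive S g t (derive_on S g t).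
Proof. by []. Qed.

End DerivativeRules.

(** * The class [K] and complex linear equations *)

Section ClassK1Theory.
Context {R : realType}.
Local Notation C := R[i].
Context {n : nat} {t0 : R} {A : 'M[R]_n} {K : set (R -> R)}.
Local Notation I := (half_line t0).
Hypothesis HK : is_class_K1 I A K.

Lemma K1_zero : K (fun=> 0).
Proof.
have [g Kg] := K1_nonempty HK.
rewrite (_ : (fun=> 0) = fun t => 0 * g t); first exact: (K1_scale HK).
by apply/funext => t; rewrite mul0r.
Qed.

Lemma K1_sum (J : Type) (r : seq J) (P : pred J) (g : J -> R -> R) :
  (forall j, P j -> K (g j)) -> K (fun t => \sum_(j <- r | P j) g j t).
Proof.
move=> Kg; elim: r => [|j r IHr].
  rewrite (_ : (fun t => _) = fun=> 0); first exact: K1_zero.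
  by apply/funext => t; rewrite big_nil.
case Pj : (P j).
  rewrite (_ : (fun t => _) = fun t => g j t + \sum_(j <- r | P j) g j t).
    by apply: (K1_add HK) => //; exact: Kg.
  by apply/funext => t; rewrite big_cons Pj.
rewrite (_ : (fun t => _) = fun t => \sum_(j <- r | P j) g j t) //.
by apply/funext => t; rewrite big_cons Pj.
Qed.

Lemma within_continuous_K1_col (v : R -> 'cV[R]_n) :
  vect_in K v -> {within I, continuous v}.
Proof.
move=> Kv.
rewrite (_ : v = fun u => \sum_i v u i 0 *: delta_mx i 0); last first.
  by apply/funext => u; exact: col_sum_delta.
elim: (index_enum _) => [|i r IHr] x.
  rewrite (_ : (fun u => _) = fun=> 0); first exact: cvg_cst.
  by apply/funext => u; rewrite big_nil.
rewrite (_ : (fun u => _) = (fun u => v u i 0 *: delta_mx i 0) +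
    (fun u => \sum_(j <- r) v u j 0 *: delta_mx j 0)).
  by apply: cvgD; [apply: cvgZr_tmp; exact: (K1_continuous HK (Kv i))|exact: IHr].
by apply/funext => u; rewrite big_cons.
Qed.

(** [K] consists of real functions, so complex ones are treated through their real and imaginary
    parts. *)
Definition complex_in (z : R -> C) : Prop :=
  K (fun t => complex.Re (z t)) /\ K (fun t => complex.Im (z t)).

Definition has_complex_derive (z : R -> C) (t : R) (l : C) : Prop :=
  has_derive I (fun u => complex.Re (z u)) t (complex.Re l) /\
  has_derive I (fun u => complex.Im (z u)) t (complex.Im l).

Lemma complex_in0 : complex_in (fun=> 0).
Proof. by split; exact: K1_zero. Qed.

Lemma complex_inD z w :
  complex_in z -> complex_in w -> complex_in (fun t => z t + w t).
Proof.
move=> [z1 z2] [w1 w2]; split.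
- rewrite (_ : (fun t => _) = fun t => complex.Re (z t) + complex.Re (w t)).
    exact: (K1_add HK).
  by apply/funext => t; rewrite raddfD.
- rewrite (_ : (fun t => _) = fun t => complex.Im (z t) + complex.Im (w t)).
    exact: (K1_add HK).
  by apply/funext => t; rewrite raddfD.
Qed.

Lemma complex_inM (c : C) z : complex_in z -> complex_in (fun t => c * z t).
Proof.
case: c => a b [z1 z2]; split.
- rewrite (_ : (fun t => _) = fun t => a * complex.Re (z t) + (- b) * complex.Im (z t)).
    by apply: (K1_add HK); exact: (K1_scale HK).
  by apply/funext => t; case: (z t) => x y /=; rewrite mulNr.
- rewrite (_ : (fun t => _) = fun t => a * complex.Im (z t) + b * complex.Re (z t)).
    by apply: (K1_add HK); exact: (K1_scale HK).
  by apply/funext => t; case: (z t) => x y /=.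
Qed.

Lemma complex_in_sum (J : Type) (r : seq J) (z : J -> R -> C) :
  (forall j, complex_in (z j)) -> complex_in (fun t => \sum_(j <- r) z j t).
Proof.
move=> Kz; elim: r => [|j r IHr].
  rewrite (_ : (fun t => _) = fun=> 0); first exact: complex_in0.
  by apply/funext => t; rewrite big_nil.
rewrite (_ : (fun t => _) = fun t => z j t + \sum_(j <- r) z j t).
  exact: complex_inD.
by apply/funext => t; rewrite big_cons.
Qed.

Lemma has_complex_derive0 t : has_complex_derive (fun=> 0) t 0.
Proof. by split; exact: has_derive_cst. Qed.

Lemma has_complex_deriveD z w t l l' :
  has_complex_derive z t l -> has_complex_derive w t l' ->
  has_complex_derive (fun t => z t + w t) t (l + l').
Proof.
move=> [z1 z2] [w1 w2]; split; rewrite raddfD.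
- rewrite (_ : (fun t => _) = fun t => complex.Re (z t) + complex.Re (w t)).
    exact: has_deriveD.
  by apply/funext => u; rewrite raddfD.
- rewrite (_ : (fun t => _) = fun t => complex.Im (z t) + complex.Im (w t)).
    exact: has_deriveD.
  by apply/funext => u; rewrite raddfD.
Qed.

Lemma has_complex_deriveM (c : C) z t l :
  has_complex_derive z t l -> has_complex_derive (fun t => c * z t) t (c * l).
Proof.
case: c l => a b [x y] [/= z1 z2]; split => /=.
- rewrite -mulNr (_ : (fun t => _) =
      fun t => a * complex.Re (z t) + (- b) * complex.Im (z t)).
    by apply: has_deriveD; exact: has_deriveMl.
  by apply/funext => u; case: (z u) => ? ? /=; rewrite mulNr.
- rewrite (_ : (fun t => _) = fun t => a * complex.Im (z t) + b * complex.Re (z t)).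
    by apply: has_deriveD; exact: has_deriveMl.
  by apply/funext => u; case: (z u).
Qed.

Lemma has_complex_derive_sum (J : Type) (r : seq J) (z : J -> R -> C) t (l : J -> C) :
  (forall j, has_complex_derive (z j) t (l j)) ->
  has_complex_derive (fun t => \sum_(j <- r) z j t) t (\sum_(j <- r) l j).
Proof.
move=> Kz; elim: r => [|j r IHr].
  rewrite big_nil (_ : (fun t => _) = fun=> 0); first exact: has_complex_derive0.
  by apply/funext => u; rewrite big_nil.
rewrite big_cons (_ : (fun t => _) = fun t => z j t + \sum_(j <- r) z j t).
  exact: has_complex_deriveD.
by apply/funext => u; rewrite big_cons.
Qed.

Definition complex_vect_in (z : R -> 'cV[C]_n) : Prop :=
  forall i, complex_in (fun t => z t i 0).

(** [C1_on] is recovered later from the equation: for [g] with entries in [K] the right-hand side is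
    continuous. *)
Definition complex_solution (g z : R -> 'cV[C]_n) : Prop :=
  complex_vect_in z /\
  forall t, I t -> forall i, has_complex_derive (fun u => z u i 0) t
    ((map_mx (real_complex R) A *m z t + g t) i 0).

Lemma complex_vect_in_mulmx (B : 'M[C]_n) z :
  complex_vect_in z -> complex_vect_in (fun t => B *m z t).
Proof.
move=> Kz i; rewrite (_ : (fun t => _) = fun t => \sum_j B i j * z t j 0).
  by apply: complex_in_sum => j; exact: complex_inM.
by apply/funext => t; rewrite mxE.
Qed.

Lemma has_complex_derive_mulmx (B : 'M[C]_n) (z : R -> 'cV[C]_n) t (l : 'cV[C]_n) i :
  (forall i, has_complex_derive (fun u => z u i 0) t (l i 0)) ->
  has_complex_derive (fun u => (B *m z u) i 0) t ((B *m l) i 0).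
Proof.
move=> Kz; rewrite mxE (_ : (fun t => _) = fun t => \sum_j B i j * z t j 0).
  by apply: has_complex_derive_sum => j; exact: has_complex_deriveM.
by apply/funext => u; rewrite mxE.
Qed.

Lemma scalar_complex_solution (lambda : C) (g : R -> C) :
  eigenvalue (map_mx (real_complex R) A) lambda -> complex_in g ->
  exists2 y : R -> C, complex_in y &
    forall t, I t -> has_complex_derive y t (lambda * y t + g t).
Proof.
move=> Al [g1 g2].
(* The class provides a family with at most one constant; its member at parameter 0 is selected. *)
have [k [y [_ /(_ 0)[ys yR yI _ _]]]] := K1_scalar_equation HK g1 g2 Al.
exists (y 0) => // t It; have [d1 d2 e1 e2] := ys t It; split.
- by rewrite -e1; exact: derivable_onP.
- by rewrite -e2; exact: derivable_onP.
Qed.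

Local Notation AC := (map_mx (real_complex R) A).

(* Induction on s: a solution u of u' = l u + g with values in the kernel of
   mx_root_prod (l :: s) reduces the equation to one whose inhomogeneity
   (A - l) u lies in the kernel of mx_root_prod s. *)
Lemma complex_solution_mx_root_prod (s : seq C) (g : R -> 'cV[C]_n) :
  all (eigenvalue AC) s -> complex_vect_in g ->
  (forall t, mx_root_prod AC s *m g t = 0) ->
  exists z, complex_solution g z.
Proof.
elim: s g => [|l s IHs] g /=.
  (* The empty product is the identity, so [g] vanishes and the zero function is a solution. *)
  move=> _ _ g0; exists (fun=> 0).
  have z0 i : (fun=> (0 : 'cV[C]_n) i 0) = (fun=> 0) :> (R -> C).
    by apply/funext => t; rewrite mxE.
  split=> [i|t It i]; first by rewrite z0; exact: complex_in0.
  by rewrite z0 mulmx0 add0r -[g t]mul1mx g0 mxE; exact: has_complex_derive0.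
move=> /andP[Al As] Kg Mg0.
(* [Q] projects onto the kernel of the whole product, where [g] takes its values. *)
have [Q [MQ Qid]] := kernel_projection (mx_root_prod AC s *m (AC - l%:M)).
have /choice[y yP] : forall i, exists y : R -> C, complex_in y /\
    forall t, I t -> has_complex_derive y t (l * y t + g t i 0).
  by move=> i; have [y Ky yd] := scalar_complex_solution Al (Kg i); exists y.
(* The entrywise solution [u0] may leave the kernel. The constant matrix [Q] commutes with
   differentiation and fixes [g], so [Q *m u0] solves the same equation inside the kernel. *)
pose u0 t : 'cV[C]_n := \col_i y i t.
have u0i i : (fun t => u0 t i 0) = y i by apply/funext => t; rewrite mxE.
have Ku : complex_vect_in (fun t => Q *m u0 t).
  by apply: complex_vect_in_mulmx => i; rewrite u0i; exact: (yP i).1.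
have ud t i : I t ->
    has_complex_derive (fun v => (Q *m u0 v) i 0) t ((l *: (Q *m u0 t) + g t) i 0).
  move=> It; have -> : l *: (Q *m u0 t) + g t = Q *m (l *: u0 t + g t).
    by rewrite mulmxDr -scalemxAr (Qid (g t)).
  by apply: has_complex_derive_mulmx => j; rewrite u0i !mxE; exact: (yP j).2.
(* The defect [(AC - l%:M) *m (Q *m u0)] is killed by [mx_root_prod AC s], so the induction
   hypothesis supplies a correction [w]. *)
have [w [Kw wd]] : exists w, complex_solution (fun t => (AC - l%:M) *m (Q *m u0 t)) w.
  apply: IHs => //; first exact: complex_vect_in_mulmx.
  by move=> t; rewrite !mulmxA MQ mul0mx.
exists (fun t => Q *m u0 t + w t); split=> [i|t It i].
  rewrite (_ : (fun t => _) = fun t => (Q *m u0 t) i 0 + w t i 0).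
    exact: complex_inD.
  by apply/funext => t; rewrite mxE.
rewrite (_ : (fun v => _) = fun v => (Q *m u0 v) i 0 + w v i 0); last first.
  by apply/funext => v; rewrite mxE.
rewrite (_ : _ i 0 = (l *: (Q *m u0 t) + g t) i 0 +
    (AC *m w t + (AC - l%:M) *m (Q *m u0 t)) i 0).
  by apply: has_complex_deriveD; [exact: ud|exact: wd].
have addE (v v' : 'cV[C]_n) : v i 0 + v' i 0 = (v + v') i 0 by rewrite mxE.
rewrite addE; congr (fun_of_matrix _ i 0).
(* The two multiples of [l] cancel. *)
rewrite mulmxBl mul_scalar_mx mulmxDr (addrC (AC *m w t)) addrACA.
by rewrite (addrC (l *: _)) subrK (addrC (g t)) addrA.
Qed.

End ClassK1Theory.

(** * Return to real linear systems *)

Section LinearSystem.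
Context {R : realType} {n : nat} {t0 : R} {A : 'M[R]_n} {K : set (R -> R)}.
Local Notation I := (half_line t0).
Hypothesis HK : is_class_K1 I A K.

(** Since [A] and [g] are real, the real part of a complex solution solves the real system. *)
Theorem linear_system_solution (g : R -> 'cV[R]_n) : vect_in K g ->
  exists phi : R -> 'cV[R]_n,
    [/\ vect_in K phi, C1_on I phi & linear_solution I A g phi].
Proof.
move=> Kg.
pose gC t : 'cV[R[i]]_n := map_mx (real_complex R) (g t).
have KgC : @complex_vect_in _ _ K gC.
  move=> i; split.
    by rewrite (_ : (fun t => _) = fun t => g t i 0) //; apply/funext => t; rewrite mxE.
  rewrite (_ : (fun t => _) = fun=> 0); first exact: K1_zero HK.
  by apply/funext => t; rewrite mxE.
(* The product over all roots is 0, so the kernel condition of the induction holds for every [g]. *)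
have [s As s0] := mx_root_prod_eigenvalues (map_mx (real_complex R) A).
have [z [Kz zd]] : exists z, @complex_solution _ _ t0 A K gC z.
  by apply: complex_solution_mx_root_prod As KgC _ => // t; rewrite s0 mul0mx.
pose phi t : 'cV[R]_n := map_mx (fun x : R[i] => complex.Re x) (z t).
have phii i : (fun t => phi t i 0) = (fun t => complex.Re (z t i 0)).
  by apply/funext => t; rewrite mxE.
have Kphi : vect_in K phi by move=> i; rewrite phii; exact: (Kz i).1.
have phid t : I t -> has_derive I phi t (A *m phi t + g t).
  move=> It; apply: has_derive_col => i; rewrite phii.
  have [+ _] := zd t It i.
  rewrite (_ : complex.Re _ = (A *m phi t + g t) i 0) //.
  rewrite !mxE raddfD raddf_sum /=; congr (_ + _); apply: eq_bigr => j _.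
  by rewrite !mxE; case: (z t j 0) => x y /=; rewrite mul0r subr0.
exists phi; split=> //; last by move=> t It; apply: has_derive_on => //; exact: phid.
split=> [t It|]; first by have [] := has_derive_on It (phid t It).
have Kd : vect_in K (fun t => A *m phi t + g t).
  move=> i; rewrite (_ : (fun t => _) = fun t => \sum_j A i j * phi t j 0 + g t i 0).
    by apply: (K1_add HK) => //; apply: (K1_sum HK) => j _; exact: (K1_scale HK).
  by apply/funext => t; rewrite !mxE.
(* On [I] the derivative coincides with the right-hand side, whose entries lie in [K] and are
   therefore continuous. *)
apply: (@subspace_eq_continuous _ _ _ (fun t => A *m phi t + g t)).
  move=> t; rewrite inE => It; apply: esym.
  by have [] := has_derive_on It (phid t It).
exact: within_continuous_K1_col HK _ Kd.
Qed.

End LinearSystem.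

(** * Formal monomials and their ranks *)

Section Multisets.
Context {T : choiceType}.
Local Open Scope mset_scope.
Implicit Types q r : {mset T}.

Lemma perm_msetD q r : perm_eq (q `+` r) (enum_mset q ++ r).
apply/eq_seq_msetP/msetP => x.
Proof.
by rewrite !mset_seqE count_cat !count_mem_mset msetE2.
Qed.

Lemma msetD_eq0 q r : (q `+` r == mset0) = (q == mset0) && (r == mset0).
Proof. by rewrite -!size_mset_eq0 (perm_size (perm_msetD q r)) size_cat addn_eq0. Qed.

Lemma size_msetD q r : size (q `+` r) = (size q + size r)%N.
Proof. by rewrite (perm_size (perm_msetD q r)) size_cat. Qed.

Lemma msubset_addl q r : q `<=` q `+` r.
Proof. by apply/msubsetP => x; rewrite msetE2 leq_addr. Qed.

Lemma msubset_addr q r : r `<=` q `+` r.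
Proof. by apply/msubsetP => x; rewrite msetE2 leq_addl. Qed.

(** Induction on the list of elements: a part of [x] plus [s] either lies in [s] or is [x] added to
    a part of [s]. *)
Lemma finite_msubset q : finite_set [set r : {mset T} | r `<=` q].
Proof.
rewrite -(seq_mset_id q); elim: (enum_mset q) => [|x s IHs].
  apply: (@sub_finite_set _ _ [set mset0]) => // r /=.
  rewrite (_ : seq_mset [::] = mset0) ?msubset0; first by move/eqP.
  by apply/msetP => y; rewrite mset_seqE mset0E.
rewrite mset_cons.
apply: (@sub_finite_set _ _ ([set r | r `<=` seq_mset s] `|`
    (fun r => x +` r) @` [set r | r `<=` seq_mset s])); last first.
  by rewrite finite_setU; split => //; exact: finite_image.
move=> r /= /msubsetP rs.
have [xr|xr] := boolP (x \in r); [right|left].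
  exists (r `\ x); last exact: msetB1K.
  apply/msubsetP => y; rewrite msetB1E; have := rs y; rewrite mset1DE.
  by case: (y == x) => /=; rewrite ?add1n ?add0n ?subn0// leq_subLR add1n.
apply/msubsetP => y; have := rs y; rewrite mset1DE.
by have [->|] := eqVneq y x => //; rewrite (mset_eq0P xr).
Qed.

(** The first summand determines the second as a difference. Hence the sums in [fmul] are finite. *)
Lemma finite_msetD q : finite_set [set p : {mset T} * {mset T} | p.1 `+` p.2 = q].
Proof.
apply: (@sub_finite_set _ _ ((fun r => (r, q `\` r)) @` [set r | r `<=` q])).
  by move=> [r s] /= <-; exists r; [exact: msubset_addl|rewrite msetDKB].
by apply: finite_image; exact: finite_msubset.
Qed.

End Multisets.

(** * Rank of a monomial and of the terms of its derivative *)

Section Rank.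
Context {R : realType} {m : nat}.
Variable varrho : 'I_m -> R.
Implicit Types q r : {mset ('I_m * nat)%type}%mset.
Local Open Scope mset_scope.

(** With factors listed according to multiplicity, additivity of the rank becomes concatenation of
    lists. *)
Lemma mrank_enum q :
  mrank varrho q = \sum_(x <- enum_mset q) (varrho x.1 + x.2%:R).
Proof.
rewrite big_mset; apply: eq_bigr => x _.
by rewrite Monoid.iteropE iter_addr_0 mulr_natr.
Qed.

Lemma mrankD q r : mrank varrho (q `+` r) = mrank varrho q + mrank varrho r.
Proof. by rewrite !mrank_enum (perm_big _ (perm_msetD q r)) big_cat. Qed.

Lemma mrank1 x : mrank varrho [mset x] = varrho x.1 + x.2%:R.
Proof. by rewrite mrank_enum enum_msetn big_seq1. Qed.

Hypothesis varrho_gt0 : forall l, 0 < varrho l.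

Lemma mrank_gt0 q : q != mset0 -> 0 < mrank varrho q.
Proof.
rewrite mrank_enum -size_mset_eq0; case: (enum_mset q) => // x s _.
rewrite big_cons ltr_pwDl //; first by rewrite ltr_pwDl.
by apply: sumr_ge0 => y _; rewrite addr_ge0 // ltW.
Qed.

(** The complementary factor is a nonconstant monomial, of positive rank. *)
Lemma mrank_lt q r : r `<=` q -> r != q -> mrank varrho r < mrank varrho q.
Proof.
move=> rq rNq; rewrite -(msetBDKC rq) mrankD ltrDl; apply: mrank_gt0.
by apply: contra rNq; rewrite msetB_eq0 eqEmsubset rq.
Qed.

Lemma dmonomial_neq0 r q : dmonomial r q != 0%N ->
  exists2 x, x \in r & raise x +` (r `\ x) = q.
Proof.
apply: contra_neqP => /forall2NP rq; rewrite /dmonomial big_seq big1 // => x xr.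
by case: eqP => // xq; case: (rq x) => // -[]; rewrite -msuppE.
Qed.

(** One factor [(l, r)] becomes [(l, r.+1)], and the order of derivation enters the rank
    additively. *)
Lemma dmonomial_mrank r q : dmonomial r q != 0%N ->
  mrank varrho q = mrank varrho r + 1.
Proof.
move=> /dmonomial_neq0[x xr <-]; rewrite -{2}(msetB1K xr) !mrankD !mrank1 /=.
by rewrite -natr1 addrA [RHS]addrAC.
Qed.

Lemma dmonomial0l q : dmonomial mset0 q = 0%N.
Proof.
by apply/eqP/negPn/negP => /dmonomial_neq0[x]; rewrite in_mset0.
Qed.

(** Every term of a derivative contains a raised factor. *)
Lemma dmonomial0r q : dmonomial q mset0 = 0%N.
Proof.
apply/eqP/negPn/negP => /dmonomial_neq0[x _ /eqP].
by rewrite msetD_eq0 -size_mset_eq0 enum_msetn.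
Qed.

(** Such an [r] arises from [q] by lowering one of its factors. For a factor of order 0 the
    predecessor gives a spurious monomial, harmless for an inclusion. *)
Lemma finite_dmonomial q : finite_set [set r : monomial m | dmonomial r q != 0%N].
Proof.
apply: (@sub_finite_set _ _
    ((fun y => (y.1, y.2.-1) +` (q `\ y)) @` [set` finsupp q])).
  move=> r /= /dmonomial_neq0[x xr rq]; exists (raise x) => /=.
    by rewrite msuppE -rq in_mset1D eqxx.
  by rewrite -rq msetD1K -surjective_pairing msetB1K.
by apply: finite_image; exact: finite_fset.
Qed.

End Rank.

(** * Formal series *)

Section Locality.
Context {R : realType} {m : nat}.
Local Open Scope mset_scope.
Implicit Types (q r : {mset ('I_m * nat)%type}).

(** Inclusion of multisets is divisibility of monomials. A coefficient of a product involves only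
    divisors of its monomial, so this relation passes to products, powers and Taylor sums. *)
Definition agree_below (V : Type) q (F G : @fseries m V) : Prop :=
  forall r, r `<=` q -> F r = G r.

Lemma agree_below_fmul (V : lmodType R) q (F F' : @fseries m R) (G G' : @fseries m V) :
  agree_below q F F' -> agree_below q G G' ->
  agree_below q (fmul F G) (fmul F' G').
Proof.
move=> FF' GG' r rq; apply: eq_fsbigr => -[p1 p2]; rewrite inE /= => pr.
have p1q : p1 `<=` q by apply: msubset_trans rq; rewrite -pr; exact: msubset_addl.
have p2q : p2 `<=` q by apply: msubset_trans rq; rewrite -pr; exact: msubset_addr.
by rewrite (FF' _ p1q) (GG' _ p2q).
Qed.

Lemma agree_below_fpow n q (F F' : @fseries m 'cV[R]_n) wp :
  agree_below q F F' -> agree_below q (fpow F wp) (fpow F' wp).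
Proof.
move=> FF'; apply: (big_ind2 (agree_below q)) => // [F1 F2 G1 G2|j _].
  exact: agree_below_fmul.
elim: (wp j) => [|k IHk] //=.
by apply: agree_below_fmul => // r rq; rewrite FF'.
Qed.

Lemma agree_below_ftaylor n q d (F F' : @fseries m 'cV[R]_n) :
  agree_below q F F' -> agree_below q (ftaylor d F) (ftaylor d F').
Proof.
move=> FF' r rq; apply: eq_fsbigr => wp _.
by rewrite (agree_below_fpow wp FF').
Qed.

(** The prefactor [eps_l] leaves to the Taylor series only the cofactor [p2] of [q], whose divisors
    are proper divisors of [q]. *)
Lemma eq_fperturbation n q d (F F' : @fseries m 'cV[R]_n) :
  (forall r, r `<=` q -> r != q -> F r = F' r) ->
  fperturbation d F q = fperturbation d F' q.
Proof.
move=> FF'; apply: eq_bigr => l _; apply: eq_fsbigr => -[p1 p2].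
rewrite inE /= => pq; rewrite /fmonom.
case: eqP => [p1E|_]; last by rewrite !scale0r.
congr (_ *: _); apply: (@agree_below_ftaylor _ p2) => //; last exact: msubset_refl.
move=> r rp; apply: FF'.
  by apply: msubset_trans rp _; rewrite -pq msubset_addr.
(* The multiplicity of [(l, 0)] in [q] exceeds that in [p2] by one, so [q] does not divide [p2]. *)
apply: contraTneq rp => ->; apply/negP => /msubsetP/(_ (l, 0%N)).
by rewrite -pq p1E mset1DE eqxx add1n ltnn.
Qed.

Lemma fperturbation0 n d (F : @fseries m 'cV[R]_n) : fperturbation d F mset0 = 0.
Proof.
rewrite /fperturbation big1 // => l _; apply: fsbig1 => -[p1 p2] /= /eqP.
rewrite msetD_eq0 => /andP[/eqP -> _]; rewrite /fmonom.
case: eqP; last by rewrite scale0r.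
by move/msetP/(_ (l, 0%N)); rewrite mset0E msetnxx.
Qed.

Lemma eq_fderiv_monomials n (varrho : 'I_m -> R) q (F F' : @fseries m 'cV[R]_n) :
  (forall r, mrank varrho r < mrank varrho q -> F r = F' r) ->
  fderiv_monomials F q = fderiv_monomials F' q.
Proof.
move=> FF'; apply: eq_fsbigr => r _.
have [->|/(dmonomial_mrank varrho) qr] := eqVneq (dmonomial r q) 0%N.
  by rewrite !scale0r.
by rewrite FF' // qr ltrDl.
Qed.

Lemma fderiv_monomials0 n (F : @fseries m 'cV[R]_n) : fderiv_monomials F mset0 = 0.
Proof. by apply: fsbig1 => r _; rewrite dmonomial0r scale0r. Qed.

(** The monomial 1 has derivative 0; this allows the ansatz to be replaced by [fdelta]. *)
Lemma eq_fderiv_monomials_neq0 n q (F F' : @fseries m 'cV[R]_n) :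
  (forall r, r != mset0 -> F r = F' r) ->
  fderiv_monomials F q = fderiv_monomials F' q.
Proof.
move=> FF'; apply: eq_fsbigr => r _.
by have [->|/FF' ->//] := eqVneq r mset0; rewrite dmonomial0l !scale0r.
Qed.

End Locality.

(** * Order of a formal series, measured by total degree *)

Section Order.
Context {R : realType} {m : nat}.
Local Open Scope mset_scope.
Implicit Types (q r : {mset ('I_m * nat)%type}) (F G : @fseries m R).

Definition order_ge (k : nat) F : Prop :=
  forall q : {mset ('I_m * nat)%type}, (size q < k)%N -> F q = 0.

Lemma order_ge_fmulr k k' F G :
  order_ge k F -> order_ge k' G -> order_ge (k + k') (fmulr F G).
Proof.
move=> Fk Gk q qk; apply: fsbig1 => -[p1 p2] /= pq.
have [p1k|p1k] := ltnP (size (enum_mset p1)) k; first by rewrite Fk // scale0r.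
rewrite Gk ?scaler0 // -(ltn_add2l k); apply: leq_ltn_trans qk.
by rewrite -pq size_msetD leq_add2r.
Qed.

(** Each factor without constant term contributes degree at least 1. So only the [wp] with sum at
    most [size q] reach [q], and the Taylor sum is finite. *)
Lemma order_ge_fpow n (F : @fseries m 'cV[R]_n) (wp : {ffun 'I_n -> nat}) :
  F mset0 = 0 -> order_ge (\sum_j wp j)%N (fpow F wp).
Proof.
move=> F0; rewrite /fpow.
apply: (big_ind2 (fun (x : @fseries m R) k => order_ge k x)) => // [? ? ? ?|j _].
  exact: order_ge_fmulr.
elim: (wp j) => [|k IHk] //=; rewrite -(add1n k); apply: order_ge_fmulr => // q.
by rewrite ltnS leqn0 size_mset_eq0 => /eqP ->; rewrite F0 mxE.
Qed.

End Order.

(** * Membership of the coefficients in [K] *)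

Section Multipliers.
Context {R : realType} {n m : nat} {t0 : R} {A : 'M[R]_n} {K : set (R -> R)}.
Hypothesis HK : is_class_K1 (half_line t0) A K.
Local Open Scope mset_scope.
Implicit Types (q r : {mset ('I_m * nat)%type}).

(* K need not contain the constants, so the coefficients of the powers of a
   series over K (whose zeroth power is 1) are only multipliers of K. *)
Definition multiplier (g : R -> R) : Prop :=
  forall u, K u -> K (fun t => g t * u t).

Lemma multiplier_cst (a : R) : multiplier (fun=> a).
Proof. by move=> u Ku; exact: (K1_scale HK). Qed.

Lemma K1_multiplier g : K g -> multiplier g.
Proof. by move=> Kg u Ku; exact: (K1_mul HK). Qed.

Lemma multiplierM g h :
  multiplier g -> multiplier h -> multiplier (fun t => g t * h t).
Proof.
move=> Kg Kh u Ku; rewrite (_ : (fun t => _) = fun t => g t * (h t * u t)).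
  exact/Kg/Kh.
by apply/funext => t; rewrite mulrA.
Qed.

Lemma multiplier_sum (J : Type) (s : seq J) (g : J -> R -> R) :
  (forall j, multiplier (g j)) -> multiplier (fun t => \sum_(j <- s) g j t).
Proof.
move=> Kg u Ku; rewrite (_ : (fun t => _) = fun t => \sum_(j <- s) g j t * u t).
  by apply: (K1_sum HK) => j _; exact: Kg.
by apply/funext => t; rewrite mulr_suml.
Qed.

Definition multiplier_series (F : R -> @fseries m R) : Prop :=
  forall q, multiplier (fun t => F t q).

Lemma multiplier_series_fmulr F G :
  multiplier_series F -> multiplier_series G ->
  multiplier_series (fun t => fmulr (F t) (G t)).
Proof.
move=> KF KG q.
rewrite (_ : (fun t => _) = fun t =>
    \sum_(p <- fset_set [set p : monomial m * monomial m | p.1 `+` p.2 = q])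
      F t p.1 * G t p.2).
  by apply: multiplier_sum => p; exact: multiplierM.
apply/funext => t; rewrite /fmulr /fmul fsbig_finite //.
exact: finite_msetD.
Qed.

Lemma multiplier_series_fpow (F : R -> @fseries m 'cV[R]_n) wp :
  (forall q, vect_in K (fun t => F t q)) ->
  multiplier_series (fun t => fpow (F t) wp).
Proof.
move=> KF; rewrite /fpow.
elim: (index_enum _) => [|j s IHs].
  move=> q; rewrite (_ : (fun t => _) = fun=> @fmonom R m mset0 q).
    exact: multiplier_cst.
  by apply/funext => t; rewrite big_nil.
rewrite (_ : (fun t => _) = fun t => fmulr (fexp (fun q => F t q j 0) (wp j))
    (\big[@fmulr R m/@fmonom R m mset0]_(j <- s) fexp (fun q => F t q j 0) (wp j))).
  apply: multiplier_series_fmulr => //.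
  elim: (wp j) => [|k IHk] /=; first by move=> q; exact: multiplier_cst.
  apply: (multiplier_series_fmulr _ IHk) => q; exact/K1_multiplier/KF.
by apply/funext => t; rewrite big_cons.
Qed.

(** A cube of multi-indices with entries at most [k], which contains all those of sum at most
    [k]. *)
Definition multi_indices_le (k : nat) : {fset {ffun 'I_n -> nat}} :=
  [fset x in [seq [ffun j => h j : nat] | h : {ffun 'I_n -> 'I_k.+1}]]%fset.

Lemma mem_multi_indices_le k (wp : {ffun 'I_n -> nat}) :
  (\sum_j wp j <= k)%N -> wp \in multi_indices_le k.
Proof.
move=> wpk; rewrite in_fset; apply/mapP.
exists [ffun j => inord (wp j)]; rewrite ?mem_enum //.
apply/ffunP => j; rewrite !ffunE inordK // ltnS (leq_trans _ wpk) //.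
by rewrite (bigD1 j) //= leq_addr.
Qed.

(** One finite index set serves all [t], and each term is a constant times a multiplier times an
    entry of [d wp]. *)
Lemma vect_in_ftaylor (d : {ffun 'I_n -> nat} -> R -> 'cV[R]_n)
    (F : R -> @fseries m 'cV[R]_n) q :
  (forall wp, vect_in K (d wp)) -> (forall q, vect_in K (fun t => F t q)) ->
  (forall t, F t mset0 = 0) ->
  vect_in K (fun t => ftaylor (fun wp => d wp t) (F t) q).
Proof.
move=> Kd KF F0 i.
rewrite (_ : (fun t => _) = fun t => \sum_(wp <- multi_indices_le (size q))
    (\prod_(j < n) (wp j)`!)%:R^-1 * (fpow (F t) wp q * d wp t i 0)).
  apply: (K1_sum HK) => wp _; apply: (K1_scale HK).
  by apply: multiplier_series_fpow => //; exact: Kd.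
apply/funext => t; rewrite /ftaylor (fsbigTE (multi_indices_le (size q))).
  by rewrite summxE; apply: eq_bigr => wp _; rewrite mxE mulrA.
move=> wp wpq; rewrite order_ge_fpow ?mulr0 ?scale0r //.
by rewrite ltnNge; apply: contra wpq => /mem_multi_indices_le.
Qed.

Lemma vect_in_fperturbation (d : 'I_m -> {ffun 'I_n -> nat} -> R -> 'cV[R]_n)
    (F : R -> @fseries m 'cV[R]_n) q :
  (forall l wp, vect_in K (d l wp)) -> (forall q, vect_in K (fun t => F t q)) ->
  (forall t, F t mset0 = 0) ->
  vect_in K (fun t => fperturbation (fun l wp => d l wp t) (F t) q).
Proof.
move=> Kd KF F0 i.
rewrite (_ : (fun t => _) = fun t => \sum_l
    \sum_(p <- fset_set [set p : monomial m * monomial m | p.1 `+` p.2 = q])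
      @fmonom R m [mset (l, 0%N)] p.1 * ftaylor (fun wp => d l wp t) (F t) p.2 i 0).
  apply: (K1_sum HK) => l _; apply: (K1_sum HK) => p _; apply: (K1_scale HK).
  exact: vect_in_ftaylor.
apply/funext => t; rewrite summxE; apply: eq_bigr => l _.
rewrite /fmul fsbig_finite; last exact: finite_msetD.
by rewrite summxE; apply: eq_bigr => p _; rewrite mxE.
Qed.

Lemma vect_in_fderiv_monomials (F : R -> @fseries m 'cV[R]_n) q :
  (forall q, vect_in K (fun t => F t q)) ->
  vect_in K (fun t => fderiv_monomials (F t) q).
Proof.
move=> KF i.
rewrite (_ : (fun t => _) = fun t =>
    \sum_(r <- fset_set [set r : monomial m | dmonomial r q != 0%N])
      (dmonomial r q)%:R * F t r i 0).
  by apply: (K1_sum HK) => r _; apply: (K1_scale HK); exact: KF.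
apply/funext => t.
rewrite /fderiv_monomials
  (fsbigTE (fset_set [set r : monomial m | dmonomial r q != 0%N])).
  by rewrite summxE; apply: eq_bigr => r _; rewrite mxE.
move=> r; rewrite in_fset_set; last exact: finite_dmonomial.
by rewrite notin_setE /= => /negP/negPn/eqP ->; rewrite scale0r.
Qed.

End Multipliers.

(** * The recursion along the enumeration of the ranks *)

Section RankEnumeration.
Context {R : realType} {m : nat} {varrho : 'I_m -> R} {rho : nat -> R}.
Context {kappa : nat -> nat} {nu : forall s, 'I_(kappa s) -> monomial m}.
Hypothesis Hnu : rank_enumeration varrho rho nu.
Implicit Types sp : sp_index kappa.

Lemma nu_ofP sp :
  nu_of nu sp != mset0 /\ mrank varrho (nu_of nu sp) = rho (tag sp).
Proof.
suff : [set q | q != mset0 /\ mrank varrho q = rho (tag sp)] (nu_of nu sp) by [].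
by rewrite -(nu_range Hnu); exists (tagged sp).
Qed.

Lemma rho_lt s s' : (rho s < rho s') = (s < s')%N.
Proof.
apply/idP/idP => [|/(rho_increasing Hnu)//].
apply: contraTT; rewrite -leqNgt -leNgt leq_eqVlt.
by move=> /predU1P[->//|/(rho_increasing Hnu)/ltW].
Qed.

(** The rank determines the level because [rho] is strictly increasing; within a level [nu] is
    injective. *)
Lemma nu_of_inj : injective (nu_of nu).
Proof.
move=> sp sp' nuE.
have tagE : tag sp = tag sp'.
  have rhoE : rho (tag sp) = rho (tag sp').
    by rewrite -(nu_ofP sp).2 -(nu_ofP sp').2 nuE.
  by case: (ltngtP (tag sp) (tag sp')) => //; rewrite -rho_lt rhoE ltxx.
case: sp sp' tagE nuE => [s p] [s' p'] /= ss'; case: _ / ss' in p' * => nuE.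
by congr existT; exact: (nu_injective Hnu nuE).
Qed.

Lemma nu_of_surj q : q != mset0 -> exists sp, nu_of nu sp = q.
Proof.
move=> q0; have : range rho (mrank varrho q) by rewrite (rho_range Hnu); exists q.
move=> [s _ rhos].
have : range (@nu s) q by rewrite (nu_range Hnu); split.
by move=> [p _ <-]; exists (Tagged (fun s => 'I_(kappa s)) p).
Qed.

Section Coefficients.
Context {n : nat}.
Implicit Types phi psi : sp_index kappa -> R -> 'cV[R]_n.

(** By injectivity of [nu_of] a single term of the sum remains. *)
Lemma fdelta_nu_of phi sp : fdelta nu phi (nu_of nu sp) = phi sp.
Proof.
apply/funext => t; rewrite /fdelta.
transitivity (\sum_(sp' \in [set sp]) phi sp' t); last by rewrite fsbig_set1.
by apply: eq_fsbigl; apply/seteqP; split => [sp' /nu_of_inj|_ ->].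
Qed.

Lemma fdelta0 phi t : fdelta nu phi mset0 t = 0.
Proof. by apply: fsbig1 => sp /= nu0; have [] := nu_ofP sp; rewrite nu0 eqxx. Qed.

Lemma vect_in_fdelta (K : set (R -> R)) phi q :
  K (fun=> 0) -> (forall sp, vect_in K (phi sp)) -> vect_in K (fdelta nu phi q).
Proof.
move=> K0 Kphi; have [->|/nu_of_surj[sp <-]] := eqVneq q mset0.
  move=> i; rewrite (_ : (fun t => _) = fun=> 0) //.
  by apply/funext => t; rewrite fdelta0 mxE.
by rewrite fdelta_nu_of.
Qed.

Lemma eq_fdelta_mrank psi psi' s :
  (forall sp, (tag sp < s)%N -> psi sp = psi' sp) ->
  forall q, mrank varrho q < rho s -> fdelta nu psi q = fdelta nu psi' q.
Proof.
move=> psiE q qs; have [->|q0] := eqVneq q mset0.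
  by apply/funext => t; rewrite !fdelta0.
have [sp nuE] := nu_of_surj q0; rewrite -nuE !fdelta_nu_of; apply: psiE.
by rewrite -rho_lt -(nu_ofP sp).2 nuE.
Qed.

Hypothesis varrho_gt0 : forall l, 0 < varrho l.

(** Both parts see only lower ranks: derivative terms come from rank one less, perturbation terms
    from proper divisors. *)
Lemma eq_g_coef d psi psi' sp :
  (forall sp', (tag sp' < tag sp)%N -> psi sp' = psi' sp') ->
  g_coef nu d psi sp = g_coef nu d psi' sp.
Proof.
move=> psiE; apply/funext => t; rewrite /g_coef.
have deltaE := eq_fdelta_mrank psiE; have [_ rankE] := nu_ofP sp.
congr (- _ + _).
  by apply: (eq_fderiv_monomials (varrho := varrho)) => r rlt; rewrite deltaE // -rankE.
apply: eq_fperturbation => r rs rN.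
by rewrite deltaE // -rankE; exact: mrank_lt.
Qed.

Context {t0 : R} {A : 'M[R]_n} {K : set (R -> R)}.
Hypothesis HK : is_class_K1 (half_line t0) A K.

Lemma vect_in_g_coef (d : 'I_m -> {ffun 'I_n -> nat} -> R -> 'cV[R]_n) phi sp :
  (forall l wp, vect_in K (d l wp)) -> (forall sp, vect_in K (phi sp)) ->
  vect_in K (g_coef nu d phi sp).
Proof.
move=> Kd Kphi.
have Kdelta q : vect_in K (fun t => fdelta nu phi q t).
  exact: vect_in_fdelta (K1_zero HK) Kphi.
move=> i; rewrite (_ : (fun t => _) = fun t =>
    -1 * fderiv_monomials (fun q => fdelta nu phi q t) (nu_of nu sp) i 0 +
    fperturbation (fun l wp => d l wp t) (fun q => fdelta nu phi q t)
      (nu_of nu sp) i 0); last by apply/funext => t; rewrite !mxE mulN1r.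
apply: (K1_add HK).
  by apply: (K1_scale HK); exact: (vect_in_fderiv_monomials HK).
by apply: (vect_in_fperturbation HK) => // t; exact: fdelta0.
Qed.

(* The s-th iterate of the solution operator is already exact on the indices of
   level less than s, since g_sp involves only lower levels. *)
Lemma exists_coefficients (d : 'I_m -> {ffun 'I_n -> nat} -> R -> 'cV[R]_n) :
  (forall l wp, vect_in K (d l wp)) ->
  exists phi : sp_index kappa -> R -> 'cV[R]_n, forall sp,
    [/\ vect_in K (phi sp), C1_on (half_line t0) (phi sp)
      & linear_solution (half_line t0) A (g_coef nu d phi sp) (phi sp)].
Proof.
move=> Kd.
have /choice[Sol SolP] : forall g : R -> 'cV[R]_n, exists y, vect_in K g ->
    [/\ vect_in K y, C1_on (half_line t0) y & linear_solution (half_line t0) A g y].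
  (* Outside [K] the value [g] is a dummy that makes [Sol] total. *)
  move=> g; have [Kg|NKg] := pselect (vect_in K g); last by exists g.
  by have [y yP] := linear_system_solution HK Kg; exists y.
pose approx k : sp_index kappa -> R -> 'cV[R]_n :=
  iter k (fun psi sp => Sol (g_coef nu d psi sp)) (fun _ => cst 0).
(* All iterates have entries in [K], so [Sol] is applied only where it returns genuine solutions. *)
have Kapprox k sp : vect_in K (approx k sp).
  elim: k sp => [|k IHk] sp /=.
    move=> i; rewrite (_ : (fun t => _) = fun=> 0); first exact: K1_zero HK.
    by apply/funext => t; rewrite mxE.
  by have [] := SolP _ (vect_in_g_coef sp Kd IHk).
have approxS k sp : (tag sp < k)%N -> approx k.+1 sp = approx k sp.
  elim: k sp => // k IHk sp; rewrite ltnS => spk /=; congr Sol.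
  by apply: eq_g_coef => sp' sp'sp; apply: IHk; exact: leq_trans spk.
(* Level [s] becomes exact at iterate [s.+1], one step after the levels below it. *)
pose phi sp := approx (tag sp).+1 sp.
have approxE k sp : (tag sp < k)%N -> approx k sp = phi sp.
  elim: k => // k IHk; rewrite ltnS leq_eqVlt => /predU1P[<-//|spk].
  by rewrite approxS // IHk.
exists phi => sp.
(* By construction [phi sp] is [Sol] applied to the right-hand side built from [approx (tag sp)],
   which agrees with [phi] on all lower levels. *)
have gE : g_coef nu d phi sp = g_coef nu d (approx (tag sp)) sp.
  by apply: eq_g_coef => sp' /approxE.
by rewrite gE; apply: SolP; exact: vect_in_g_coef.
Qed.

(** Coefficient by coefficient: the monomial 1 gives the equation of [phi0], and any other monomial
    is some [nu_of nu sp] and gives the equation of [phi sp]. *)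
Lemma formal_solution_fansatz (f phi0 : R -> 'cV[R]_n) d phi :
  linear_solution (half_line t0) A f phi0 ->
  (forall sp, linear_solution (half_line t0) A (g_coef nu d phi sp) (phi sp)) ->
  formal_solution (half_line t0) A f d (fansatz nu phi0 phi).
Proof.
move=> phi0P phiP t It q.
have ansatz0 : fansatz nu phi0 phi mset0 = phi0.
  by apply/funext => u; rewrite /fansatz eqxx fdelta0 addr0.
have ansatz_neq0 r : r != mset0 -> fansatz nu phi0 phi r = fdelta nu phi r.
  by move=> rN; apply/funext => u; rewrite /fansatz (negPf rN) add0r.
have -> : (fun q' => if q' == mset0 then 0 else fansatz nu phi0 phi q' t) =
    (fun q' => fdelta nu phi q' t).
  apply/funext => r; case: eqVneq => [->|rN]; first by rewrite fdelta0.
  by rewrite ansatz_neq0.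
rewrite /fderiv; have [->|q0] := eqVneq q mset0.
  have [d0 e0] := phi0P t It.
  by rewrite ansatz0 e0 fderiv_monomials0 fperturbation0.
have [sp spq] := nu_of_surj q0.
rewrite ansatz_neq0 // -spq fdelta_nu_of.
have [dsp ->] := phiP sp t It; split => //.
(* The contribution of the differentiated monomials cancels the negative term of [g_coef]. *)
rewrite addr0 -addrA; congr (_ + _); rewrite /g_coef.
rewrite (@eq_fderiv_monomials_neq0 _ _ _ _ _ (fun r => fdelta nu phi r t)).
  by rewrite addrAC addNr add0r.
by move=> r rN; rewrite ansatz_neq0.
Qed.

End Coefficients.
End RankEnumeration.

Theorem mainTheorem1 (R : realType) (n m : nat) (t0 : R) (A : 'M[R]_n)
  (K : set (R -> R)) (f : R -> 'cV[R]_n)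
  (n0 : nat) (phi0 : 'rV[R]_n0 -> R -> 'cV[R]_n)
  (a : R) (eps : 'I_m -> R -> R) (fl : 'I_m -> R -> 'cV[R]_n -> 'cV[R]_n)
  (varrho : 'I_m -> R)
  (rho : nat -> R) (kappa : nat -> nat)
  (nu : forall s, 'I_(kappa s) -> monomial m) :
  let I := half_line t0 in
  let D := fun c0 => tube I (phi0 c0) a in
  let dfl := fun c0 l wp t => multi_pderiv (D c0) wp (fl l) t (phi0 c0 t) in
  (2 <= n)%N ->
  (1 <= m)%N ->
  is_class_K1 I A K ->
  vect_in K f ->
  (n0 <= n)%N ->
  (forall c0, [/\ linear_solution I A f (phi0 c0),
                  vect_in K (phi0 c0) & C1_on I (phi0 c0)]) ->
  0 < a ->
  (forall l, Cinf_on I (eps l) /\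
     forall s : nat, iter s (derive_on I) (eps l) t @[t --> +oo] --> 0) ->
  (forall c0 l, C0inf (D c0) (fl l)) ->
  (forall c0 l (wp : {ffun 'I_n -> nat}),
     (exists M : R, forall t y, D c0 (t, y) ->
        `|multi_pderiv (D c0) wp (fl l) t y| <= M) /\
     vect_in K (dfl c0 l wp)) ->
  (forall l, 0 < varrho l) ->
  (forall l l' : 'I_m, (l <= l')%N -> varrho l <= varrho l') ->
  rank_enumeration varrho rho nu ->
  exists (N : sp_index kappa -> nat)
    (phi : 'rV[R]_n0 -> (forall sp, 'rV[R]_(N sp)) ->
           sp_index kappa -> R -> 'cV[R]_n),
    [/\ (forall sp, (N sp <= n)%N),
        (forall S : nat,
           (n0 + \sum_(s < S) \sum_(p < kappa s)
                   N (existT (fun s => 'I_(kappa s)) (nat_of_ord s) p)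
              <= n)%N),
        (forall c0 (c c' : forall sp, 'rV[R]_(N sp)) sp,
           (forall sp', (tag sp' < tag sp)%N \/ sp' = sp -> c sp' = c' sp') ->
           phi c0 c sp = phi c0 c' sp),
        (forall c0 (psi psi' : sp_index kappa -> R -> 'cV[R]_n) sp,
           (forall sp', (tag sp' < tag sp)%N -> psi sp' = psi' sp') ->
           g_coef nu (dfl c0) psi sp = g_coef nu (dfl c0) psi' sp)
      & forall c0 c,
          (forall sp,
             [/\ vect_in K (phi c0 c sp), C1_on I (phi c0 c sp)
               & linear_solution I A (g_coef nu (dfl c0) (phi c0 c) sp)
                   (phi c0 c sp)]) /\
          formal_solution I A f (dfl c0) (fansatz nu (phi0 c0) (phi c0 c))].
Proof.
move=> I D dfl _ _ HK _ n0n phi0P _ _ _ dflP varrho0 _ Hnu.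
have Kd c0 l wp : vect_in K (dfl c0 l wp) by exact: (dflP c0 l wp).2.
(* The recursion is run separately for each value of [c0]. *)
have /choice[phi phiP] : forall c0, exists phi : sp_index kappa -> R -> 'cV[R]_n,
    forall sp, [/\ vect_in K (phi sp), C1_on I (phi sp)
      & linear_solution I A (g_coef nu (dfl c0) phi sp) (phi sp)].
  by move=> c0; exact: (exists_coefficients Hnu varrho0 HK (Kd c0)).
(* The constants are then those of [c0] alone, [n0] in number, and each [phi sp] is constant in
   [c]. *)
exists (fun=> 0%N), (fun c0 _ => phi c0); split=> //.
- by move=> S; rewrite big1 ?addn0 // => s _; rewrite big1.
- by move=> c0 psi psi' sp; exact: (eq_g_coef Hnu varrho0).
move=> c0 c; split; first exact: phiP.
apply: (formal_solution_fansatz Hnu); first by have [] := phi0P c0.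
by move=> sp; have [] := phiP c0 sp.
Qed.
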